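(* Let $(X,d)$ be a complete regular semimetric space with a triangle function $\Phi$ for $d$, let $\varphi$ be a comparison function and let $T\colon X\to X$ be a $\varphi$-contraction. Let $x_0\in X$ be the unique fixed point of $T$, let $x\in X$ and define the sequence $(x_k)_{k\ge1}$ recursively by $x_1:=x$, $x_{k+1}:=T(x_k)$. Define $\psi:\mathbb{R}_+\to[0,\infty]$ by $$\psi(t):=\sup\{s\geq0\mid s\leq \Phi(t,\varphi(s))\}\qquad(t\in\mathbb{R}_+).$$ Then, for all $k\in\mathbb{N}=\{1,2,\dots\}$ and all $\ell\in\{1,\dots,k\}$, $$d(x_k,x_0)\le\psi\bigl(\varphi^{k-\ell}(d(x_\ell,x_{\ell+1}))\bigr),$$ and, for all $k\ge2$, $$d(x_k,x_0)\le\varphi(d(x_{k-1},x_0)).$$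
   Context: $\mathbb{R}_+=[0,\infty)$. A semimetric space $(X,d)$ is a nonempty set $X$ with a symmetric function $d:X\times X\to\mathbb{R}_+$ such that $d(x,y)=0$ if and only if $x=y$ (no triangle inequality is assumed). A triangle function for $d$ is a symmetric function $\Phi:\mathbb{R}_+^2\to[0,\infty]$, monotone increasing (in the weak sense) in both arguments, with $\Phi(0,0)=0$ and $d(x,y)\le\Phi(d(x,z),d(z,y))$ for all $x,y,z\in X$. The space is regular if it admits some triangle function that is continuous at $(0,0)$. A sequence $(x_n)$ converges to $x$ if $d(x_n,x)\to0$; it is Cauchy if for every $\varepsilon>0$ there is $n_0$ with $d(x_n,x_m)<\varepsilon$ for $n,m\ge n_0$; the space is complete if every Cauchy sequence converges. A comparison function is a map $\varphi:\mathbb{R}_+\to\mathbb{R}_+$ that is increasing ($s\le t$ implies $\varphi(s)\le\varphi(t)$) and satisfies $\lim_{m\to\infty}\varphi^m(t)=0$ for all $t>0$, where $\varphi^m$ is the $m$-th iterate ($\varphi^0$ is the identity). A map $T:X\to X$ is a $\varphi$-contraction if $d(T(x),T(y))\le\varphi(d(x,y))$ for all $x,y\in X$. It is known (Bessenyei--Páles) that a $\varphi$-contraction of a complete regular semimetric space has a unique fixed point. The symbol $x_0$ denotes the fixed point and is not a term of the iteration, which starts at $x_1$. *)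

(* Defs.v *)
From mathcomp Require Import all_boot all_order all_algebra.
From mathcomp Require Import all_classical all_reals ereal topology normedtype
  sequences.

Set Implicit Arguments.
Unset Strict Implicit.
Unset Printing Implicit Defensive.

Import Order.TTheory GRing.Theory Num.Theory.
Import numFieldNormedType.Exports.

Local Open Scope classical_set_scope.
Local Open Scope ring_scope.

(* Functions on [0, +oo[ are represented by functions on the whole of R whose
   values at negative arguments are irrelevant: every condition below is
   relativized to nonnegative arguments. *)

Record semimetric (R : realType) (X : Type) (d : X -> X -> R) : Prop :=
  Semimetric {
    semimetric_inhabited : inhabited X;
    semimetric_ge0 : forall x y, 0 <= d x y;
    semimetric_sym : forall x y, d x y = d y x;
    semimetric_eq0 : forall x y, d x y = 0 <-> x = y
  }.

Record triangle_function (R : realType) (X : Type) (d : X -> X -> R)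
    (Phi : R -> R -> \bar R) : Prop := TriangleFunction {
  triangle_function_ge0 :
    forall a b, 0 <= a -> 0 <= b -> (0 <= Phi a b)%E;
  triangle_function_sym :
    forall a b, 0 <= a -> 0 <= b -> Phi a b = Phi b a;
  triangle_function_le : forall a a' b b',
    0 <= a -> 0 <= b -> a <= a' -> b <= b' -> (Phi a b <= Phi a' b')%E;
  triangle_function00 : Phi 0 0 = 0%E;
  triangle_functionP : forall x y z, ((d x y)%:E <= Phi (d x z) (d z y))%E
}.

(* Continuity at the origin is that of the restriction of Phi to the closed
   first quadrant, with values in the topological space \bar R. *)
Definition semimetric_regular (R : realType) (X : Type) (d : X -> X -> R) :
    Prop :=
  exists2 Phi : R -> R -> \bar R, triangle_function d Phi &
    Phi p.1 p.2 @[p --> within [set p : R * R | 0 <= p.1 /\ 0 <= p.2]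
                               (nbhs ((0, 0) : R * R))] --> Phi 0 0.

Definition semimetric_cvg (R : realType) (X : Type) (d : X -> X -> R)
    (u : nat -> X) (l : X) : Prop :=
  d (u n) l @[n --> \oo] --> (0 : R).

Definition semimetric_cauchy (R : realType) (X : Type) (d : X -> X -> R)
    (u : nat -> X) : Prop :=
  forall e : R, 0 < e -> exists n0 : nat,
    forall n m : nat, (n0 <= n)%N -> (n0 <= m)%N -> d (u n) (u m) < e.

Definition semimetric_complete (R : realType) (X : Type) (d : X -> X -> R) :
    Prop :=
  forall u : nat -> X, semimetric_cauchy d u -> exists l, semimetric_cvg d u l.

Record comparison_function (R : realType) (phi : R -> R) : Prop :=
  ComparisonFunction {
    comparison_function_ge0 : forall t, 0 <= t -> 0 <= phi t;
    comparison_function_le : forall s t, 0 <= s -> s <= t -> phi s <= phi t;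
    comparison_function_cvg : forall t, 0 < t ->
      iter m phi t @[m --> \oo] --> (0 : R)
  }.

Definition phi_contraction (R : realType) (X : Type) (d : X -> X -> R)
    (phi : R -> R) (T : X -> X) : Prop :=
  forall x y, d (T x) (T y) <= phi (d x y).

Definition psi (R : realType) (Phi : R -> R -> \bar R) (phi : R -> R) (t : R) :
    \bar R :=
  ereal_sup [set s%:E | s in
    [set s : R | 0 <= s /\ (s%:E <= Phi t (phi s))%E]].

(* Main.v *)
(* Since T x0 = x0, the number s = d (x_k, x0) satisfies, by the triangle
   inequality through x_(k+1) = T x_k,
   s <= Phi (d (x_k, x_(k+1))) (d (T x_k, T x0)) <= Phi t (phi s) with
   t = phi^(k-l) (d (x_l, x_(l+1))), so that s belongs to the set whose
   supremum is psi t. *)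

Require Import Defs.
From mathcomp Require Import all_boot all_order all_algebra.
From mathcomp Require Import all_classical all_reals ereal topology normedtype
  sequences.

Import Order.TTheory GRing.Theory Num.Theory.
Import numFieldNormedType.Exports.

Local Open Scope classical_set_scope.
Local Open Scope ring_scope.

Lemma phi_contraction_iter (R : realType) (X : Type) (d : X -> X -> R)
    (phi : R -> R) (T : X -> X) (m : nat) (y z : X) :
  semimetric d -> comparison_function phi -> phi_contraction d phi T ->
  d (iter m T y) (iter m T z) <= iter m phi (d y z).
Proof.
move=> d_semimetric phi_comparison T_contraction.
elim: m => [|m IHm] //=; apply: le_trans (T_contraction _ _) _.
by apply: (comparison_function_le phi_comparison) => //; exact: semimetric_ge0.
Qed.

(** Letting [t] be any upper bound of [d y (T y)] leaves the passage to [t] to the monotonicity of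
    [Phi] in its first argument, so that monotonicity of [psi] need not be established. *)
Lemma le_psi (R : realType) (X : Type) (d : X -> X -> R)
    (Phi : R -> R -> \bar R) (phi : R -> R) (T : X -> X) (x0 y : X) (t : R) :
  semimetric d -> triangle_function d Phi -> phi_contraction d phi T ->
  T x0 = x0 -> d y (T y) <= t -> ((d y x0)%:E <= psi Phi phi t)%E.
Proof.
move=> d_semimetric Phi_triangle T_contraction Tx0 dyTy.
have d_ge0 := semimetric_ge0 d_semimetric.
apply: ereal_sup_ubound; exists (d y x0) => //; split=> //.
apply: le_trans (triangle_functionP Phi_triangle y x0 (T y)) _.
apply: (triangle_function_le Phi_triangle) => //.
by rewrite -{1}Tx0; exact: T_contraction.
Qed.

Theorem theorem12 (R : realType) (X : Type) (d : X -> X -> R)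
    (Phi : R -> R -> \bar R) (phi : R -> R) (T : X -> X)
    (d_semimetric : semimetric d) (d_complete : semimetric_complete d)
    (d_regular : semimetric_regular d) (Phi_triangle : triangle_function d Phi)
    (phi_comparison : comparison_function phi)
    (T_contraction : phi_contraction d phi T)
    (x0 : X) (x0_fixed : unique (fun y => T y = y) x0)
    (x : X) (u : nat -> X) (u1 : u 1%N = x)
    (uS : forall k, (1 <= k)%N -> u k.+1 = T (u k)) :
  (forall k l : nat, (1 <= l)%N -> (l <= k)%N ->
     ((d (u k) x0)%:E <= psi Phi phi (iter (k - l) phi (d (u l) (u l.+1))))%E)
  /\
  (forall k : nat, (2 <= k)%N -> d (u k) x0 <= phi (d (u k.-1) x0)).
Proof.
have [Tx0 _] := x0_fixed; split=> [k l l_gt0 lek|[//|[//|k _]]]; last first.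
  by rewrite uS // -{1}Tx0; exact: T_contraction.
(* The recursion holds only from index 1 on and [u 0] is arbitrary, so the orbit is counted from
   [u l], with [l] positive. *)
have u_iter m : u (m + l)%N = iter m T (u l).
  by elim: m => [//|m IHm]; rewrite addSn uS ?ltn_addl //= IHm.
(* Moving the extra [T] innermost makes [u k] and [T (u k)] the images of [u l] and [T (u l)] under
   the same iterate of [T], of order [k - l]. *)
apply: le_psi => //; rewrite -{1 2}(subnK lek) u_iter -iterS iterSr uS //.
exact: phi_contraction_iter.
Qed.
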